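(* Let $X$ be a regular Lindelöf space such that $F(X)=\omega$. Then $F(X_\delta) \leq 2^{\aleph_0}$.
   Context: Regular spaces are assumed to be $T_1$. For a space $X$, $X_\delta$ (the $G_\delta$-modification of $X$) is the set $X$ with the topology generated by the $G_\delta$-subsets of $X$ (the $G_\delta$-subsets of $X$ form a base). A subset $\{x_\alpha: \alpha <\kappa \}$ of a space $Z$ is a free sequence in $Z$ if $\overline{\{x_\beta:\beta<\alpha \}}\cap \overline{\{x_\beta:\alpha \le \beta<\kappa \}}=\emptyset$ for each $\alpha <\kappa$ (closures in $Z$). $F(Z)$ is the supremum of the cardinalities of free sequences in $Z$; as usual for cardinal functions, values are taken to be infinite, so $F(X)=\omega$ means that $X$ has no uncountable free sequence. *)

(* Defs.v *)
From HB Require Import structures.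
From mathcomp Require Import all_boot all_order.
From mathcomp Require Import all_classical wochoice.
From mathcomp Require Import topology borel_hierarchy.

Set Implicit Arguments.
Unset Strict Implicit.
Unset Printing Implicit Defensive.

Local Open Scope classical_set_scope.
Local Open Scope card_scope.

Definition lindelof_space (X : topologicalType) :=
  forall U : set (set X),
    (forall A, U A -> open A) -> \bigcup_(A in U) A = [set: X] ->
  exists V : set (set X),
    [/\ V `<=` U, countable V & \bigcup_(A in V) A = [set: X]].

Lemma GdeltaI (X : topologicalType) (A B : set X) :
  Gdelta A -> Gdelta B -> Gdelta (A `&` B).
Proof.
move=> [F oF ->] [G oG ->]; exists (fun n => F n `&` G n).
  by move=> n; exact: openI.
by rewrite bigcapI.
Qed.

Definition gdelta_mod (X : topologicalType) : Type := X.

Section gdelta_topology.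
Context (X : topologicalType).

HB.instance Definition _ := Choice.on (gdelta_mod X).

Let gdelta_cover :
  \bigcup_(A in [set A : set X | Gdelta A]) A = [set: gdelta_mod X].
Proof.
by apply/seteqP; split=> // x _; exists setT => //; exact/open_Gdelta/openT.
Qed.

Let gdelta_join (A B : set X) (x : gdelta_mod X) :
  Gdelta A -> Gdelta B -> A x -> B x ->
  exists C : set X, [/\ Gdelta C, C x & C `<=` A `&` B].
Proof. by move=> gA gB Ax Bx; exists (A `&` B); split => //; exact: GdeltaI. Qed.

HB.instance Definition _ := isBaseTopological.Build (gdelta_mod X)
  gdelta_cover gdelta_join.

End gdelta_topology.

(* [I], ordered by the non-strict relation [R], is (isomorphic to) a cardinal,
   i.e., an initial ordinal: it is equipotent to none of its proper initial
   segments [{b | b < a}]. *)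
Definition cardinal_order (I : Type) (R : rel I) :=
  well_order R /\ forall a : I, ~ ([set: I] #<= [set b | ~~ R a b]).

(* As [R] is total, [~~ R a b] means b < a. The closures being disjoint, such
   an [x] is injective, so that [range x] has the cardinality of [I]. *)
Definition free_sequence (Z : topologicalType) (I : Type) (R : rel I)
    (x : I -> Z) :=
  cardinal_order R /\
  forall a : I, closure (x @` [set b | ~~ R a b]) `&`
                closure (x @` [set b | R a b]) = set0.

(* Cardinals are represented by sets up to equipotence: [free_number_le Z K]
   is F(Z) <= |K| and [free_number_eq Z K] is F(Z) = |K|, where F(Z) is the
   supremum, taken to be infinite, of the cardinalities of free sequences. *)
Definition free_number_le (Z : topologicalType) (V : Type) (K : set V) :=
  infinite_set K /\
  forall (I : Type) (R : rel I) (x : I -> Z),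
    free_sequence R x -> range x #<= K.

Definition free_number_eq (Z : topologicalType) (V : Type) (K : set V) :=
  free_number_le Z K /\
  forall (W : Type) (L : set W), free_number_le Z L -> K #<= L.

(* Main.v *)
(** Write c for the continuum. Two facts are proved by closing off a subset of
X of size c under operations with countably many arguments and then building,
inside it, a free sequence of length omega_1 should the fact fail.
(1) Every cover of X by G_delta sets has a subcover of size c: the closure of
a countable set causes no difficulty, because in a regular space a G_delta
neighbourhood of y is determined, up to shrinking, by the traces on the
countable set of neighbourhoods of y, and there are c many traces.
(2) Points in the closure in X_delta of A are in the closure of a subset of A
of size c.
A free sequence of length c^+ in X_delta then has, by (1), a point p in the
closure of all its tails; by (2), p is in the closure of a subset of size c,
hence of a proper initial segment, a contradiction. *)

Require Import Defs.
From mathcomp Require Import all_boot all_order.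
From mathcomp Require Import all_classical wochoice.
From mathcomp Require Import topology borel_hierarchy.

Set Implicit Arguments.
Unset Strict Implicit.
Unset Printing Implicit Defensive.

Local Open Scope classical_set_scope.
Local Open Scope card_scope.

(** * Well-orders: induction, recursion and initial segments *)

Section well_orders.
Context (I : Type) (R : rel I).
Hypothesis woR : well_order R.

Definition below (a : I) : set I := [set b | ~~ R a b].

Lemma well_order_min (A : set I) :
  A !=set0 -> exists2 a, A a & forall b, A b -> R a b.
Proof.
move=> [a Aa]; have [|z [[Az zmin] _]] := woR (A := fun b => `[<A b>]).
  by exists a; exact/asboolP.
exists z; first by move/asboolP: Az.
by move=> b Ab; apply: zmin; exact/asboolP.
Qed.

(** [well_order] provides unique least elements of nonempty sets; the order axioms follow by
    applying it to sets of two or three points. *)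
Lemma well_order_total : total R.
Proof.
move=> a b; have [|z [->|->] zmin] := @well_order_min [set a; b].
- by exists a; left.
- by rewrite (zmin b) //; right.
- by rewrite (zmin a) ?orbT //; left.
Qed.

Lemma well_order_refl : reflexive R.
Proof. by move=> a; rewrite -[R a a]orbb well_order_total. Qed.

Lemma well_order_anti : antisymmetric R.
Proof.
move=> a b /andP[ab ba].
have [|z [_ zuniq]] := woR (A := fun c => `[<c = a \/ c = b>]).
  by exists a; apply/asboolP; left.
apply: (etrans (esym (zuniq a _)) (zuniq b _)).
  split=> [|c /asboolP[->|->//]]; last exact: well_order_refl.
  by apply/asboolP; left.
split=> [|c /asboolP[->//|->]]; last exact: well_order_refl.
by apply/asboolP; right.
Qed.

Lemma well_order_trans : transitive R.
Proof.
move=> b a c ab bc.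
have [|z abc zmin] := @well_order_min [set d | [\/ d = a, d = b | d = c]].
  by exists a; constructor 1.
case: abc zmin => -> zmin.
- by apply: zmin; constructor 3.
- rewrite (_ : a = b) //; apply: well_order_anti.
  by rewrite ab zmin //; constructor 1.
- rewrite (_ : c = b) //; apply: well_order_anti.
  by rewrite bc zmin //; constructor 2.
Qed.

Lemma well_order_ind (P : I -> Prop) :
  (forall a, (forall b, below a b -> P b) -> P a) -> forall a, P a.
Proof.
move=> IH; apply: contrapT => /existsNP[a nPa].
have [|z nPz zmin] := @well_order_min [set b | ~ P b]; first by exists a.
apply: nPz; apply: IH => b zb; apply: contrapT => /zmin.
exact/negP.
Qed.

Lemma well_order_wf : well_founded (fun b a => below a b).
Proof. by apply: well_order_ind => a IH; constructor. Qed.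

Lemma belowW a b : below a b -> R b a.
Proof. by move=> /negbTE ab; have := well_order_total a b; rewrite ab. Qed.

Lemma below_trans a b c : R b a -> below b c -> below a c.
Proof.
move=> ba bc; apply/negP => ac; move/negP: bc; apply.
exact: well_order_trans ac.
Qed.

(** Take [I] itself, or the segment below the least [a] whose segment is too large. [J] stands for
    the successor cardinal of [K]: omega_1 or c^+ below. *)
Lemma well_order_segment (V : Type) (K : set V) : ~ ([set: I] #<= K) ->
  exists2 J : set I, ~ (J #<= K) & forall a, J a -> below a #<= K.
Proof.
move=> IK; have [allK|/existsNP[a0 na0]] := pselect (forall a, below a #<= K).
  by exists setT.
have [|a aK amin] := @well_order_min [set b | ~ (below b #<= K)].
  by exists a0.
exists (below a) => // b ab; apply: contrapT => /amin.
exact/negP.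
Qed.

Lemma well_order_rec (X : Type) (F : set (set X) -> X) :
  exists x : I -> X,
    forall a, x a = F [set x @` below b | b in [set b | R b a]].
Proof.
(* Here [f] is given only on the predecessors of [a], so each image carries a proof [h]; [E] below
   removes it. *)
pose G a (f : forall b, below a b -> X) :=
  F [set D | exists2 b, R b a &
     D = [set y | exists c (h : below a c), below b c /\ f c h = y]].
exists (Fix well_order_wf (fun=> X) G) => a.
rewrite Fix_eq; last first.
  move=> b f g fg; congr G; apply: functional_extensionality_dep => c.
  exact: functional_extensionality_dep.
rewrite /G; congr F; apply/seteqP.
have E b : R b a -> [set y | exists c (_ : below a c), below b c /\
      Fix well_order_wf (fun=> X) G c = y] =
    Fix well_order_wf (fun=> X) G @` below b.
  move=> ba; apply/seteqP; split=> [y [c [_ [bc <-]]]|y [c bc <-]].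
    by exists c.
  by exists c, (below_trans ba bc).
split=> D [b ba].
  by move=> ->; exists b => //; rewrite -E.
by move=> <-; exists b => //; rewrite -E.
Qed.

End well_orders.

Lemma well_order_sub (I : Type) (R : rel I) (S : set I) :
  well_order R -> well_order (fun a b : S => R (val a) (val b)).
Proof.
move=> woR A [s As].
have [|_ [a Aa <-] amin] := well_order_min woR (A := val @` [set b | b \in A]).
  by exists (val s), s.
exists a; split=> [|b [Ab bmin]].
  by split=> // b Ab; apply: amin; exists b.
apply: val_inj; apply: (well_order_anti woR).
by rewrite (bmin a) // amin //; exists b.
Qed.

(** * Sets of size at most the continuum *)

Lemma card_le_sets (T : Type) (Q : countType) (A : set T) (f : T -> set Q) :
  {in A &, injective f} -> A #<= [set: set nat].
Proof.
move=> injf; apply/pcard_injP; exists (fun t => pickle @` f t) => a b aA bA E.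
apply: injf => //; have sub (u v : T) : pickle @` f u = pickle @` f v ->
    f u `<=` f v.
  move=> uv q uq; have : (pickle @` f v) (pickle q) by rewrite -uv; exists q.
  by move=> [r vr /(pcan_inj pickleK) <-].
by apply/seteqP; split; exact: sub.
Qed.

Lemma infinite_sets_nat : infinite_set [set: set nat].
Proof.
apply/infiniteP/pcard_injP; exists (fun n => [set n]) => a b _ _ E.
by have : [set a] a by []; rewrite E.
Qed.

Lemma uncountable_sets_nat : ~ countable [set: set nat].
Proof.
move=> /countable_injP[f injf].
pose D : set nat := [set n | exists2 A, f A = n & ~ A n].
have nD : ~ D (f D).
  move=> /[dup] DD [A /injf]; rewrite !inE => /(_ Logic.I Logic.I) ->.
  by apply.
by apply: (nD); exists D.
Qed.

(** This is c * c = c: a point is coded by the disjoint union of the code of an index [i] chosen for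
    it and its own code within [F i]. *)
Lemma bigcup_card_le_continuum (T U : Type) (D : set T) (F : T -> set U) :
    D #<= [set: set nat] -> (forall i, D i -> F i #<= [set: set nat]) ->
  \bigcup_(i in D) F i #<= [set: set nat].
Proof.
move=> /pcard_injP[f injf] cF.
have [g injg] : {g : T -> U -> set nat &
    forall i, D i -> {in F i &, injective (g i)}}.
  apply: (@choice _ _ (fun i g => D i -> {in F i &, injective g})) => i.
  have [Di|nDi] := pselect (D i); last by exists (fun=> set0).
  by have /pcard_injP[g ?] := cF i Di; exists g.
have [h hP] : {h : U -> set (nat + nat) & forall u, (\bigcup_(i in D) F i) u ->
    exists i, [/\ D i, F i u & h u = inl @` f i `|` inr @` g i u]}.
  apply: (@choice _ _ (fun u s => (\bigcup_(i in D) F i) u ->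
    exists i, [/\ D i, F i u & s = inl @` f i `|` inr @` g i u])) => u.
  have [[i Di Fiu]|nu] := pselect ((\bigcup_(i in D) F i) u).
    by exists (inl @` f i `|` inr @` g i u) => _; exists i.
  by exists set0.
apply: (card_le_sets (f := h)) => u v /set_mem/hP[i [Di Fi ->]].
move=> /set_mem/hP[j [Dj Fj ->]] E.
have fij : f i = f j.
  apply/seteqP; split=> n fn.
    have : (inl @` f j `|` inr @` g j v) (inl n) by rewrite -E; left; exists n.
    by case=> -[m fm] // [<-].
  have : (inl @` f i `|` inr @` g i u) (inl n) by rewrite E; left; exists n.
  by case=> -[m fm] // [<-].
have ij : i = j by apply: injf => //; exact/mem_set.
subst j; apply: (injg i) => //; [exact/mem_set..|].
apply/seteqP; split=> n gn.
  have : (inl @` f i `|` inr @` g i v) (inr n) by rewrite -E; right; exists n.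
  by case=> -[m gm] // [<-].
have : (inl @` f i `|` inr @` g i u) (inr n) by rewrite E; right; exists n.
by case=> -[m gm] // [<-].
Qed.

(** Regularity of c^+: each [h y] has at most c predecessors, so the segments up to the values of
    [h] cannot exhaust [J]. *)
Lemma well_order_continuum_bounded (I T : Type) (R : rel I) (J : set I)
    (S : set T) (h : T -> I) :
    well_order R -> ~ (J #<= [set: set nat]) ->
    (forall a, J a -> below R a #<= [set: set nat]) ->
    S #<= [set: set nat] -> (forall y, S y -> J (h y)) ->
  exists2 a, J a & forall y, S y -> below R a (h y).
Proof.
move=> woR JK Jbelow SK SJ.
have : ~ (J `<=` \bigcup_(y in S) [set b | R b (h y)]).
  move=> /subset_card_le JS; apply: JK; apply: (card_le_trans JS).
  apply: bigcup_card_le_continuum => // y Sy.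
  apply: (@card_le_trans _ _ _
    (\bigcup_(i in [set: bool]) if i then [set h y] else below R (h y))).
    apply: subset_card_le => b by_.
    have [yb|] := boolP (R (h y) b); last by exists false.
    by exists true => //=; apply: (well_order_anti woR); rewrite by_.
  apply: bigcup_card_le_continuum => [|[] _]; last exact/Jbelow/SJ.
    by apply: (card_le_sets (f := fun i : bool => [set i])) => a b _ _ E;
       have : [set a] a by []; rewrite E.
  by apply: (card_le_sets (f := fun=> (set0 : set nat))) => a b /set_mem ->
       /set_mem ->.
move=> /existsNP[a /not_implyP[Ja aS]]; exists a => // y Sy.
by apply/negP => ay; apply: aS; exists y.
Qed.

Lemma exists_omega1 : exists (I : Type) (R : rel I),
  [/\ well_order R, ~ countable [set: I] & forall a, countable (below R a)].
Proof.
have [R woR] := well_ordering_principle (set nat).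
have [J Junc Jbelow] := well_order_segment woR uncountable_sets_nat.
exists J, (fun a b : J => R (val a) (val b)); split.
- exact: well_order_sub.
- by rewrite (eq_countable (card_setT J)).
- move=> a; have /countable_injP[f injf] := Jbelow _ (set_valP a).
  apply/countable_injP; exists (f \o val) => b c /set_mem ab /set_mem ac.
  by move=> /injf/val_inj; apply; exact/mem_set.
Qed.

(* Well-founded trees name the elements of the closure of a point under an
   operation with countably many arguments and a parameter [p : P]. *)
Inductive tree (P : Type) := Leaf | Node of P & (nat -> tree P).

(** A code consists of pairs of an address and a mark: [None] says that a node sits at the address,
    which tells [Node] from [Leaf], and [Some q] that [q] lies in its label. *)
Fixpoint tree_code (Q : Type) (t : tree (set Q)) : set (seq nat * option Q) :=
  match t with
  | Leaf => set0
  | Node p f => [set u | match u with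
                         | ([::], None) => True
                         | ([::], Some q) => p q
                         | (n :: s, o) => tree_code (f n) (s, o)
                         end]
  end.

Lemma tree_code_inj (Q : Type) : injective (@tree_code Q).
Proof.
elim=> [|p f IH] [|p' f'] //= E.
- have : (set0 : set (seq nat * option Q)) ([::], None) by rewrite E.
  by [].
- have : (set0 : set (seq nat * option Q)) ([::], None) by rewrite -E.
  by [].
- have E' u := congr1 (fun A => A u) E.
  rewrite (_ : p = p'); last by apply/funext => q; exact: (E' ([::], Some q)).
  congr Node; apply/funext => n; apply: IH; apply/funext => -[s o].
  exact: (E' (n :: s, o)).
Qed.

(** [M] consists of the values of all trees. Their codes are subsets of a countable type, hence at
    most c values; joining a sequence of trees under a new node gives closure under [Phi]. *)
Lemma continuum_closure (X : Type) (Q : countType)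
    (Phi : set Q -> (nat -> X) -> X) (x0 : X) :
  exists M : set X, [/\ M #<= [set: set nat], M x0,
    forall p f, (forall k, M (f k)) -> M (Phi p f) &
    forall y, M y -> y = x0 \/ exists p f, y = Phi p f].
Proof.
pose eval := fix eval (t : tree (set Q)) : X :=
  match t with Leaf => x0 | Node p f => Phi p (fun n => eval (f n)) end.
exists (range eval); split.
- apply: (card_le_trans (card_image_le _ _)).
  by apply: (card_le_sets (f := @tree_code Q)) => s t _ _; exact: tree_code_inj.
- by exists (@Leaf _).
- move=> p f fM.
  have [g gP] : {g : nat -> tree (set Q) & forall k, eval (g k) = f k}.
    by apply: (@choice _ _ (fun k t => eval t = f k)) => k; have [t _ <-] := fM k;
       exists t.
  by exists (Node p g) => //=; congr Phi; apply/funext.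
- by move=> _ [[|p f] _ <-] /=; [left|right; do 2 eexists].
Qed.

(** * Enumerations and free sequences of length omega_1 *)

Lemma countable_enum (T : Type) (M A : set T) :
    M !=set0 -> countable A -> A `<=` M ->
  exists2 f : nat -> T, forall k, M (f k) & A `<=` range f.
Proof.
move=> [x0 Mx0] /countable_injP[g injg] AM.
have [f fP] : {f : nat -> T & forall k, M (f k) /\
    forall y, A y -> g y = k -> f k = y}.
  apply: (@choice _ _ (fun k x => M x /\ forall y, A y -> g y = k -> x = y)).
  move=> k; have [[y Ay yk]|nk] := pselect (exists2 y, A y & g y = k).
    exists y; split=> [|z Az zk]; first exact: AM.
    by apply: injg; rewrite ?inE // yk.
  by exists x0; split=> // y Ay yk; case: nk; exists y.
exists f => [k|y Ay]; first by case: (fP k).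
by exists (g y) => //; have [_ /(_ y Ay erefl)] := fP (g y).
Qed.

(** If [S] were uncountable, its proper segments being countable, its order would be that of a
    cardinal and [x] would be an uncountable free sequence on it. *)
Lemma free_sequence_countable (X : topologicalType) (I : Type) (R : rel I)
    (x : I -> X) (S : set I) :
    free_number_le X [set: nat] -> well_order R -> (forall a, S a -> countable (below R a)) ->
    (forall a, S a -> closure (x @` (S `&` below R a)) `&`
                      closure (x @` (S `&` [set b | R a b])) = set0) ->
  countable S.
Proof.
move=> freeX woR cR disj; apply: contrapT => uncS.
pose R' := fun a b : S => R (val a) (val b).
have woR' : well_order R' by exact: well_order_sub.
have disj' (a : S) : closure ((x \o val) @` [set b | ~~ R' a b]) `&`
    closure ((x \o val) @` [set b | R' a b]) = set0.
  rewrite -subset0 => y [y1 y2]; rewrite -(disj _ (set_valP a)); split.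
    by apply: closureS y1 => _ [b ab <-]; exists (val b) => //; split=> //;
       exact: set_valP.
  by apply: closureS y2 => _ [b ab <-]; exists (val b) => //; split=> //;
     exact: set_valP.
have cS a : countable [set b | ~~ R' a b].
  have /countable_injP[f injf] := cR _ (set_valP a).
  apply/countable_injP; exists (f \o val) => b c /set_mem ab /set_mem ac.
  by move=> /injf/val_inj; apply; exact/mem_set.
have free : free_sequence R' (x \o val).
  split=> //; split=> // a Sa; apply: uncS.
  by rewrite -(eq_countable (card_setT S)); exact: sub_countable Sa (cS a).
have := freeX.2 _ _ _ free => cx.
apply: uncS; rewrite -(eq_countable (card_setT S)).
suff injx : {in [set: S] &, injective (x \o val)}.
  by rewrite -(eq_countable (inj_card_eq injx)).
have lt_neq (a b : S) : R' a b = false -> x (val a) <> x (val b).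
  move=> ab xab; have : set0 (x (val a)); last by [].
  rewrite -(disj' a); split; apply: subset_closure.
    by exists b => //=; rewrite ab.
  by exists a => //=; exact: well_order_refl.
move=> a b _ _ xab; apply: (well_order_anti woR').
apply/andP; split; apply/negPn/negP => /negbTE/lt_neq; exact.
Qed.

(** [K D] is the condition that a set [D] of earlier values puts on later ones. At stage [b] only
    countably many [D] occur, one for each [a] up to [b], and [stepK] meets all their conditions at
    once. *)
Lemma omega1_recursion (X : Type) (M : set X) (K : set X -> set X) :
    (forall E : set (set X), countable E ->
       (forall D, E D -> countable D /\ D `<=` M) ->
       exists2 y, M y & forall D, E D -> K D y) ->
  exists (I : Type) (R : rel I) (x : I -> X),
    [/\ well_order R, ~ countable [set: I], forall a, countable (below R a),
        range x `<=` M & forall a b, R a b -> K (x @` below R a) (x b)].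
Proof.
move=> stepK; have [I [R [woR uncI cR]]] := exists_omega1.
have [y0 _ _] : exists2 y, M y & forall D, set0 D -> K D y by exact: stepK.
have [F FP] : {F : set (set X) -> X & forall E, countable E ->
    (forall D, E D -> countable D /\ D `<=` M) ->
    M (F E) /\ forall D, E D -> K D (F E)}.
  apply: (@choice _ _ (fun E y => countable E ->
    (forall D, E D -> countable D /\ D `<=` M) ->
    M y /\ forall D, E D -> K D y)) => E.
  have [[cE EM]|nE] := pselect (countable E /\
      forall D, E D -> countable D /\ D `<=` M).
    by have [y My Ky] := stepK E cE EM; exists y.
  by exists y0 => cE EM; case: nE.
have [x xE] := well_order_rec woR F.
have leR b : countable [set c | R c b].
  apply: (@sub_countable _ _ _ (below R b `|` [set b])).
    apply: subset_card_le => c cb; have [bc|] := boolP (R b c); last by left.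
    by right; apply: (well_order_anti woR); rewrite cb.
  by rewrite -bigcup2E; apply: bigcup_countable => // -[|[|n]] _ /=.
have xP b : M (x b) /\ forall a, R a b -> K (x @` below R a) (x b).
  elim/(well_order_ind woR): b => b IH; rewrite xE.
  have [||MF KF] := FP [set x @` below R a | a in [set a | R a b]].
  - exact: sub_countable (card_image_le _ _) (leR b).
  - move=> _ [a ab <-]; split; first exact: sub_countable (card_image_le _ _) _.
    by move=> _ [c ac <-]; apply: (IH _ _).1; exact: below_trans ac.
  by split=> // a ab; apply: KF; exists a.
exists I, R, x; split=> // [_ [b _ <-]|a b ab]; first exact: (xP b).1.
exact: (xP b).2.
Qed.

(** * Regular and Lindelöf spaces *)

Lemma regular_nbhs_closure (X : topologicalType) (x : X) (B : set X) :
    regular_space X -> nbhs x B ->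
  exists2 U, open_nbhs x U & closure U `<=` B.
Proof.
move=> regX /regX[U]; rewrite nbhsE => -[V xV VU] UB; exists V => //.
exact: subset_trans (closureS VU) UB.
Qed.

(** With the complement of [H] added, the sets [O y] cover [X]; the other members of a countable
    subcover are traced back to points of [M]. *)
Lemma lindelof_subcover (X : topologicalType) (H M : set X) (O : X -> set X) :
    lindelof_space X -> closed H -> (forall y, M y -> open (O y)) ->
    H `<=` \bigcup_(y in M) O y ->
  exists Y, [/\ countable Y, Y `<=` M & H `<=` \bigcup_(y in Y) O y].
Proof.
move=> lindX clH openO HM.
have [||V [VU cV VT]] := lindX ((O @` M) `|` [set ~` H]).
- by move=> _ [[y My <-]|->]; [exact: openO|rewrite openC].
- apply/seteqP; split=> // y _; have [/HM[z Mz Oz]|nHy] := pselect (H y).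
    by exists (O z) => //; left; exists z.
  by exists (~` H) => //; right.
have [[y0 _]|M0] := pselect (M !=set0); last first.
  exists set0; split=> // y /HM[z Mz _]; by case: M0; exists z.
have [g gP] : {g : set X -> X & forall A, (O @` M) A -> M (g A) /\ O (g A) = A}.
  apply: (@choice _ _ (fun A z => (O @` M) A -> M z /\ O z = A)) => A.
  have [[z Mz zA]|nA] := pselect ((O @` M) A); last by exists y0.
  by exists z.
exists (g @` (V `&` (O @` M))); split.
- apply: sub_countable cV; apply: (card_le_trans (card_image_le _ _)).
  by apply: subset_card_le => A [].
- by move=> _ [A [_ MA] <-]; exact: (gP A MA).1.
- move=> y Hy; have [A VA Ay] : (\bigcup_(A in V) A) y by rewrite VT.
  have [MA|AH] := VU A VA; last by move: Ay; rewrite AH => /(_ Hy).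
  by exists (g A); [exists A|rewrite (gP A MA).2].
Qed.

(** * Covers and tightness of the G_delta-modification *)

Section gdelta_modification.
Context (X : topologicalType).
Hypothesis regX : regular_space X.
Hypothesis freeX : free_number_le X [set: nat].

Lemma closure_gdelta_mod (A : set X) (p : X) :
  closure (A : set (gdelta_mod X)) p <->
  forall G : nat -> set X, (forall n, open (G n)) -> (forall n, G n p) ->
    exists2 x, A x & forall n, G n x.
Proof.
split=> [clA G openG Gp|AG B].
  have [|x [Ax Gx]] := clA (\bigcap_n G n).
    rewrite nbhsE; exists (\bigcap_n G n) => //.
    split; last by move=> n _; exact: Gp.
    exists [set \bigcap_n G n]; last by rewrite bigcup_set1.
    by move=> _ ->; exists G.
  by exists x => // n; exact: Gx.
rewrite nbhsE => -[U [[D DG <-] [C DC Cp]] UB].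
have [G openG CE] := DG C DC; move: Cp; rewrite CE => Gp.
have [x Ax Gx] := AG G openG (fun n => Gp n Logic.I).
have Cx : C x by rewrite CE => n _; exact: Gx.
by exists x; split=> //; apply: UB; exists C.
Qed.

(** Choose [V] with closures inside [G]. If [z] and [y] have the same traces on [s], then [z], a
    limit of the points of [s] in [V (z, n)], lies in the closure of [V (y, n)], hence in [G y n].
    So [t] needs one point per trace. *)
Lemma separable_closure_trace (G : X -> nat -> set X) (s : nat -> X) (x0 : X) :
    (forall x n, nbhs x (G x n)) ->
  exists t : set (nat * nat) -> X,
    forall z, closure (range s) z -> exists d, forall n, G (t d) n z.
Proof.
move=> nbhsG.
have [V VP] : {V : X * nat -> set X & forall xn, open_nbhs xn.1 (V xn) /\
    closure (V xn) `<=` G xn.1 xn.2}.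
  apply: (@choice _ _ (fun xn V => open_nbhs xn.1 V /\
    closure V `<=` G xn.1 xn.2)) => -[x n] /=.
  by have [V xV VG] := regular_nbhs_closure regX (nbhsG x n); exists V.
pose code z : set (nat * nat) := [set nk | V (z, nk.1) (s nk.2)].
have [t tP] : {t : set (nat * nat) -> X & forall d z, code z = d ->
    code (t d) = d}.
  apply: (@choice _ _ (fun d y => forall z, code z = d -> code y = d)) => d.
  have [[z zd]|nd] := pselect (exists z, code z = d); first by exists z.
  by exists x0 => z zd; case: nd; exists z.
exists t => z sz; exists (code z) => n.
have [_] := VP (t (code z), n); apply => B zB.
have [|_ [[k _ <-] [Bk Vk]]] := sz (B `&` V (z, n)).
  by apply: filterI => //; exact/open_nbhs_nbhs/(VP (z, n)).1.
exists (s k); split=> //.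
suff : code (t (code z)) (n, k) by [].
by rewrite (tP _ z erefl).
Qed.

(* [M] plays the role of a countably closed elementary submodel: it contains
   witnesses for the covers of closures of countable subsets of [M], and for
   the failure of countable subfamilies to cover [X]. *)
Lemma gdelta_cover_continuum (G : X -> nat -> set X) :
    lindelof_space X -> (forall x n, open (G x n)) -> (forall x n, G x n x) ->
  exists2 S, S #<= [set: set nat] &
    forall z, exists2 x, S x & forall n, G x n z.
Proof.
move=> lindX openG Gxx.
have [[x0 _]|X0] := pselect ([set: X] !=set0); last first.
  by exists set0 => // z; case: X0; exists z.
have nbhsG x n : nbhs x (G x n) by apply: open_nbhs_nbhs.
have [t tP] : {t : (nat -> X) -> set (nat * nat) -> X & forall s z,
    closure (range s) z -> exists d, forall n, G (t s d) n z}.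
  apply: (@choice _ _ (fun s t => forall z,
    closure (range s) z -> exists d, forall n, G (t d) n z)) => s.
  exact: separable_closure_trace.
(* The set [d] selects countably many of the [G (f k) n]; if they do not cover [X], [w] picks a
   point outside all of them. *)
have [w wP] : {w : (nat -> X) * set (nat * nat) -> X & forall fd z,
    (forall k n, fd.2 (k, n) -> ~ G (fd.1 k) n z) ->
    forall k n, fd.2 (k, n) -> ~ G (fd.1 k) n (w fd)}.
  apply: (@choice _ _ (fun fd y => forall z,
    (forall k n, fd.2 (k, n) -> ~ G (fd.1 k) n z) ->
    forall k n, fd.2 (k, n) -> ~ G (fd.1 k) n y)) => fd.
  have [[z zP]|nz] := pselect (exists z,
      forall k n, fd.2 (k, n) -> ~ G (fd.1 k) n z); first by exists z.
  by exists x0 => z zP; case: nz; exists z.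
(* The mark [None] is a switch that merges [t] and [w] into one operation. *)
pose Phi (p : set (option (nat * nat))) f :=
  let d := [set q | p (Some q)] in if `[<p None>] then t f d else w (f, d).
have [M [cM Mx0 MPhi _]] := continuum_closure Phi x0.
have Mt f d : (forall k, M (f k)) -> M (t f d).
  move=> Mf; have := MPhi [set o | if o is Some q then d q else True] f Mf.
  by rewrite /Phi asboolT.
have Mw f d : (forall k, M (f k)) -> M (w (f, d)).
  move=> Mf; have := MPhi [set o | if o is Some q then d q else False] f Mf.
  by rewrite /Phi asboolF.
exists M => // z; apply: contrapT => nz.
have [n nP] : {n : X -> nat & forall x, M x -> ~ G x (n x) z}.
  apply: (@choice _ _ (fun x n => M x -> ~ G x n z)) => x.
  have [Mx|nMx] := pselect (M x); last by exists 0.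
  have /existsNP[n nG] : ~ forall n, G x n z by move=> Gz; apply: nz; exists x.
  by exists n.
have [Y YP] : {Y : set X -> set X & forall D, countable D -> D `<=` M ->
    [/\ countable (Y D), Y D `<=` M &
        closure D `<=` \bigcup_(y in Y D) G y (n y)]}.
  apply: (@choice _ _ (fun D Y => countable D -> D `<=` M ->
    [/\ countable Y, Y `<=` M & closure D `<=` \bigcup_(y in Y) G y (n y)])).
  move=> D; have [[cD DM]|nD] := pselect (countable D /\ D `<=` M); last first.
    by exists set0 => cD DM; case: nD.
  have [||||Y YP] := @lindelof_subcover X (closure D) M (fun y => G y (n y)).
  - by [].
  - exact: closed_closure.
  - by move=> y _; exact: openG.
  (* A point [y] of the closure lies in every [G (t f d) m] for some [d], so whichever index [n]
     selects is harmless. *)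
  - have [f fM Df] := countable_enum (ex_intro _ x0 Mx0) cD DM.
    move=> y /(closureS Df)/tP[d td].
    by exists (t f d) => //; exact: Mt.
  - by exists Y.
have [E cE EM|I [R [x [woR uncI cR xM xK]]]] := omega1_recursion (M := M)
    (K := fun D => ~` \bigcup_(y in Y D) G y (n y)).
  (* The chosen covers use countably many sets in all and miss [z]; [w] replaces [z] by a point of
     [M] that they miss too. *)
  have cYE : countable (\bigcup_(D in E) Y D).
    apply: bigcup_countable => // D ED; have [cD DM] := EM D ED.
    by have [] := YP D cD DM.
  have [|f fM YEf] := countable_enum (ex_intro _ x0 Mx0) cYE.
    move=> y [D ED]; have [cD DM] := EM D ED.
    by have [_ YM _] := YP D cD DM; exact: YM.
  pose d : set (nat * nat) := [set km | km.2 = n (f km.1)].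
  exists (w (f, d)); first exact: Mw.
  move=> D ED [y YDy].
  have [|k _ <-] := YEf y; first by exists D.
  apply: (wP (f, d) z) => //= j m; rewrite /d /= => ->; exact/nP/fM.
apply: uncI; apply: (free_sequence_countable freeX (x := x) woR) => a _.
  exact: cR.
(* The open cover chosen for the earlier values contains their closure, and the later values stay in
   its closed complement. *)
rewrite -subset0 => y [y1 y2].
have [_ _ Dcov] : [/\ countable (Y (x @` below R a)), Y (x @` below R a) `<=` M &
    closure (x @` below R a) `<=` \bigcup_(y in Y (x @` below R a)) G y (n y)].
  apply: YP; first exact: sub_countable (card_image_le _ _) (cR a).
  by move=> _ [b _ <-]; exact: xM.
have clK : closed (~` \bigcup_(y in Y (x @` below R a)) G y (n y)).
  by apply: open_closedC; apply: bigcup_open => u _; exact: openG.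
have : (~` \bigcup_(y in Y (x @` below R a)) G y (n y)) y.
  apply: clK; apply: closureS y2 => _ [b [_ ab] <-]; exact: xK.
by apply; apply: Dcov; apply: closureS y1 => _ [b [_ ab] <-]; exists b.
Qed.

(** Close a point of [A] under [phi], which picks points of [A] in countably many neighbourhoods of
    [p] at once. If the G_delta set given by some [G] separated [p] from the result, omega_1 would
    be a countable union of index sets of free sequences. *)
Lemma gdelta_tightness_continuum (A : set X) (p : X) :
    closure (A : set (gdelta_mod X)) p ->
  exists B : set X, [/\ B `<=` A, B #<= [set: set nat] &
    closure (B : set (gdelta_mod X)) p].
Proof.
move=> /closure_gdelta_mod clA.
have [x0 Ax0 _] : exists2 x, A x & forall n : nat, [set: X] x.
  by apply: (clA (fun=> setT)) => // _; exact: openT.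
have [W WP] : {W : set X -> set X & forall B, open_nbhs p (W B) /\
    (~ closure B p -> closure (W B) `&` closure B = set0)}.
  apply: (@choice _ _ (fun B W => open_nbhs p W /\
    (~ closure B p -> closure W `&` closure B = set0))) => B.
  have [Bp|nBp] := pselect (closure B p).
    by exists setT; split=> //; split=> //; exact: openT.
  have [|W pW WB] := @regular_nbhs_closure X p (~` closure B) regX.
    apply: open_nbhs_nbhs; split=> //; exact/closed_openC/closed_closure.
  by exists W; split=> // _; rewrite -subset0 => y [/WB].
pose F (d : set ((nat * nat) * nat)) (f : nat -> X) i : set X :=
  f @` [set k | d (i, k)].
have [phi phiP] : {phi : set ((nat * nat) * nat) * (nat -> X) -> X &
    forall df, A (phi df) /\ forall i, W (F df.1 df.2 i) (phi df)}.
  apply: (@choice _ _ (fun df y => A y /\ forall i, W (F df.1 df.2 i) y)) => df.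
  (* The pairs [i] are listed by numbers; a number that codes no pair imposes no condition. *)
  pose G j := if unpickle j is Some i then W (F df.1 df.2 i) else setT.
  have [||y Ay Gy] := clA G.
  - move=> j; rewrite /G; case: unpickle => [i|]; last exact: openT.
    exact: (WP _).1.1.
  - move=> j; rewrite /G; case: unpickle => // i.
    exact: (WP _).1.2.
  - exists y; split=> // i; have := Gy (pickle i).
    by rewrite /G pickleK.
have [M [cM Mx0 MPhi MA]] := continuum_closure (fun d f => phi (d, f)) x0.
exists M; split=> // [y /MA[->//|[d [f ->]]]|]; first exact: (phiP _).1.
apply/closure_gdelta_mod => G openG Gp; apply: contrapT => nG.
have MG x : M x -> exists n, ~ G n x.
  by move=> Mx; apply/existsNP => Gx; apply: nG; exists x.
have DG D n : closure (W (D `\` G n)) `&` closure (D `\` G n) = set0.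
  apply: (WP _).2 => /(_ (G n))[|y [[_ nGy] //]].
  by apply: open_nbhs_nbhs; split.
have [E cE EM|I [R [x [woR uncI cR xM xK]]]] := omega1_recursion (M := M)
    (K := fun D => \bigcap_n closure (W (D `\` G n))).
  have [|e eP Ee] :=
    @countable_enum _ [set D : set X | countable D /\ D `<=` M] E _ cE EM.
    by exists set0; split=> [|y []]; exact: countable0.
  have [|||f fM ef] := @countable_enum _ M (\bigcup_i e i).
  - by exists x0.
  - by apply: bigcup_countable => // i _; exact: (eP i).1.
  - by move=> y [i _]; exact: (eP i).2.
  (* Section [(i, n)] of [d] describes the part of [e i] outside [G n]. *)
  pose d : set ((nat * nat) * nat) :=
    [set ik | e ik.1.1 (f ik.2) /\ ~ G ik.1.2 (f ik.2)].
  exists (phi (d, f)); first exact: MPhi.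
  move=> _ /Ee[i _ <-] n _; apply: subset_closure.
  suff -> : e i `\` G n = F d f (i, n) by exact: (phiP (d, f)).2.
  apply/seteqP; split=> [y [ey nGy]|_ [k /= [ek nGk] <-]]; last by split.
  by have [|k _ kE] := ef y; [exists i|exists k => //=; rewrite /d /= kE].
apply: uncI.
(* Indices are sorted by an [n] with [x a] outside [G n]: there [p] is not a limit of the earlier
   values, so [W] separates these from the later ones. *)
have -> : [set: I] = \bigcup_n [set a | ~ G n (x a)].
  apply/seteqP; split=> // a _; have [|n nGx] := MG (x a).
    by apply: xM; exists a.
  by exists n.
apply: bigcup_countable => // n _.
apply: (free_sequence_countable freeX (x := x) woR) => a nGa; first exact: cR.
rewrite -subset0 -(DG (x @` below R a) n) => y [y1 y2]; split.
  apply: closed_closure; apply: closureS y2 => _ [b [_ ab] <-].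
  exact: xK.
by apply: closureS y1 => _ [b [nGb ab] <-]; split=> //; exists b.
Qed.

End gdelta_modification.

(** * Free sequences of length c^+ in the G_delta-modification *)

Theorem corollary8 (X : topologicalType)
    (hT1 : accessible_space X) (hreg : regular_space X)
    (hL : lindelof_space X) (hF : free_number_eq X [set: nat]) :
  free_number_le (gdelta_mod X) [set: set nat].
Proof.
have freeX := hF.1; split; first exact: infinite_sets_nat.
move=> I R x [[woR _] disj]; apply: contrapT => rxunc.
have [|J Junc Jbelow] := @well_order_segment _ _ woR _ [set: set nat].
  by move=> Ic; apply: rxunc; exact: card_le_trans (card_image_le _ _) Ic.
have [a0 Ja0] : J !=set0 by apply/set0P/eqP => J0; apply: Junc; rewrite J0.
pose tail a := x @` (J `&` [set b | R a b]).
have [p pP] : exists p, forall a, J a -> closure (tail a) p.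
  apply: contrapT => /forallNP np.
  (* Each [p] gets an index and a G_delta neighbourhood that misses the tail from there on. For c
     many neighbourhoods covering [X], some [a] bounds the indices, and [x a] is left uncovered. *)
  have [G GP] : {G : X -> I * (nat -> set X) & forall p, [/\ J (G p).1,
      forall n, open ((G p).2 n), forall n, (G p).2 n p &
      forall b, J b -> R (G p).1 b -> ~ forall n, (G p).2 n (x b)]}.
    apply: (@choice X (I * (nat -> set X)) (fun p aG => [/\ J aG.1, forall n, open (aG.2 n),
      forall n, aG.2 n p & forall b, J b -> R aG.1 b ->
      ~ forall n, aG.2 n (x b)])) => p.
    have /existsNP[a /not_implyP[Ja nap]] := np p.
    apply: contrapT => nG; apply: nap; apply/closure_gdelta_mod => G openG Gp.
    apply: contrapT => nx; apply: nG; exists (a, G); split=> //= b Jb ab Gb.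
    by apply: nx; exists (x b) => //; exists b.
  have [p n|p n|S cS Scov] :=
      gdelta_cover_continuum hreg freeX (G := fun p => (G p).2) hL.
  - by have [] := GP p.
  - by have [] := GP p.
  have [|a Ja Sa] := well_order_continuum_bounded (h := fun p => (G p).1)
      woR Junc Jbelow cS; first by move=> p _; have [] := GP p.
  have [p Sp Gp] := Scov (x a); have [_ _ _ nG] := GP p.
  by apply: (nG a) => //; apply: (belowW woR); exact: Sa.
have [|B [BA cB Bp]] := gdelta_tightness_continuum hreg freeX (A := x @` J)
    (p := p).
  by apply: closureS (pP a0 Ja0) => _ [b [Jb _] <-]; exists b.
have [h hP] : {h : X -> I & forall y, B y -> J (h y) /\ x (h y) = y}.
  apply: (@choice _ _ (fun y a => B y -> J a /\ x a = y)) => y.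
  have [/BA[a Ja xa]|nBy] := pselect (B y); last by exists a0.
  by exists a.
(* The indices of [B] are bounded in [J], so [p] is a limit of the values before [a] as well as of
   the tail at [a]. *)
have [|a Ja Ba] := well_order_continuum_bounded (h := h) woR Junc Jbelow cB.
  by move=> y By; exact: (hP y By).1.
have : set0 p; last by [].
rewrite -(disj a); split.
  by apply: closureS Bp => y By; exists (h y); [exact: Ba|exact: (hP y By).2].
by apply: closureS (pP a Ja) => _ [b [_ ab] <-]; exists b.
Qed.
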